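(* Every poset learning algorithm needs an expected number of at least $n^2/4-o(n^2)$ pairwise comparisons. Precisely: there is a function $g:\{1,2,3,\dots\}\to\mathbb{R}$ with $g(n)/n^2\to 0$ as $n\to\infty$ such that for every poset learning algorithm $\phi$ and every $n\ge 1$, $$e_\phi(n)\ \ge\ \frac{n^2}{4}-g(n).$$
   Context: For an integer $n\ge 1$, identify $n$ with the set $\{0,1,\dots,n-1\}$, and let $\mathcal P(n)$ be the set of all strict partial orders (irreflexive, transitive relations) $P\subseteq n\times n$ on this (labelled) set. For $P\in\mathcal P(n)$ and distinct $a,b\in n$, the pairwise comparison $\{a,b\}$ in $P$ reveals which one of the following holds: $a\,P\,b$, or $b\,P\,a$, or neither. A poset learning algorithm $\phi$ is a deterministic procedure which, given $n\ge 1$ and an unknown $P\in\mathcal P(n)$, obtains information about $P$ only by performing pairwise comparisons in $P$ one after another. The next pair to be compared may depend on $n$ and on the results of the previous comparisons. The procedure continues until $P$ is known, i.e. until $P$ is the only element of $\mathcal P(n)$ consistent with all the results obtained (so for each fixed $n$, $\phi$ is a ternary decision tree that identifies every $P\in\mathcal P(n)$). Let $c_\phi(P)$ be the number of pairwise comparisons that $\phi$ performs until it knows $P$. The expected number of comparisons is $$e_\phi(n):=\frac{1}{|\mathcal P(n)|}\sum_{P\in\mathcal P(n)}c_\phi(P).$$ *)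

(* Defs.v *)
From HB Require Import structures.
From mathcomp Require Import all_boot all_order all_algebra.
From mathcomp Require Import all_classical all_reals all_analysis.

Set Implicit Arguments.
Unset Strict Implicit.
Unset Printing Implicit Defensive.

Import Order.TTheory GRing.Theory Num.Theory.
Import numFieldNormedType.Exports.

Local Open Scope ring_scope.

Definition strict_order n (P : {set 'I_n * 'I_n}) : bool :=
  [forall a, (a, a) \notin P] &&
  [forall a, forall b, forall c,
     ((a, b) \in P) && ((b, c) \in P) ==> ((a, c) \in P)].

Definition posets n : {set {set 'I_n * 'I_n}} := [set P | strict_order P].

Variant answer := Below | Above | Incomparable.

Definition answer_code (r : answer) : option bool :=
  match r with
  | Below => Some true | Above => Some false | Incomparable => None
  end.

Definition answer_decode (o : option bool) : answer :=
  match o with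
  | Some true => Below | Some false => Above | None => Incomparable
  end.

Lemma answer_codeK : cancel answer_code answer_decode.
Proof. by case. Qed.

HB.instance Definition _ := Finite.copy answer (can_type answer_codeK).

Definition comparison_result n (P : {set 'I_n * 'I_n}) (a b : 'I_n) : answer :=
  if (a, b) \in P then Below else if (b, a) \in P then Above else Incomparable.

Inductive decision_tree (n : nat) : Type :=
| Stop
| Compare (a b : 'I_n) (neq_ab : a != b) (next : answer -> decision_tree n).

Definition transcript n := seq ('I_n * 'I_n * answer).

Fixpoint run n (t : decision_tree n) (P : {set 'I_n * 'I_n}) : transcript n :=
  match t with
  | Stop => [::]
  | Compare a b _ next =>
      let r := comparison_result P a b in (a, b, r) :: run (next r) P
  end.

Definition consistent n (Q : {set 'I_n * 'I_n}) (s : transcript n) : bool :=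
  all (fun q => comparison_result Q q.1.1 q.1.2 == q.2) s.

Definition known n (P : {set 'I_n * 'I_n}) (s : transcript n) : bool :=
  [set Q in posets n | consistent Q s] == [set P].

Definition identifies n (t : decision_tree n) : Prop :=
  forall P, P \in posets n -> known P (run t P).

Record learning_algorithm := LearningAlgorithm {
  tree : forall n, decision_tree n;
  tree_identifies : forall n, (0 < n)%N -> identifies (tree n)
}.

(* The least k such that P is known after the first k comparisons; a tree
   that goes on after P is known is not charged for the extra comparisons. *)
Definition comparisons (phi : learning_algorithm) n
    (P : {set 'I_n * 'I_n}) : nat :=
  let s := run (tree phi n) P in
  find (fun k => known P (take k s)) (iota 0 (size s).+1).

Definition expected_comparisons (R : realType) (phi : learning_algorithm)
    (n : nat) : R :=
  (#|posets n|%:R)^-1 * \sum_(P in posets n) (comparisons phi P)%:R.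

(* Main.v *)
Require Import Defs.
From HB Require Import structures.
From mathcomp Require Import all_boot all_order all_algebra.
From mathcomp Require Import zify ring lra.
From mathcomp Require Import all_classical all_reals all_analysis.

(** In a poset on [n] points the number of predecessors is strictly increasing.
    Once these numbers are given, a comparison has only two possible outcomes,
    "comparable" or "incomparable", so at most [n ^ n * 2 ^ j] posets are known
    after [j] comparisons.  On the other hand there are at least [2 ^ m] posets,
    with [m] the integer part of [n^2/4], since every set of pairs from one half
    of the points to the other is a poset.  Summing the number of posets not yet
    known after [j] comparisons, for [j < m - log2 (n ^ n)], shows that the mean
    number of comparisons is at least [m - log2 (n ^ n) - O(1)], and
    [log2 (n ^ n) = o(n^2)]. *)

Set Implicit Arguments.
Unset Strict Implicit.
Unset Printing Implicit Defensive.

Import Order.TTheory GRing.Theory Num.Theory.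
Import numFieldNormedType.Exports.

Local Open Scope nat_scope.

Section SublevelSets.

Variables (T : finType) (A : {set T}) (f : T -> nat).

Lemma sum_subn_sublevel k :
  \sum_(x in A) (k - f x) = \sum_(j < k) #|[set x in A | f x <= j]|.
Proof.
have subn_count x : k - f x = \sum_(j < k) (f x <= j).
  elim: k => [|k IHk]; first by rewrite big_ord0.
  by rewrite big_ord_recr -IHk /=; lia.
under eq_bigr do rewrite subn_count.
rewrite exchange_big; apply: eq_bigr => j _.
by rewrite -sum1dep_card big_mkcondr; apply: eq_bigr => x _; case: leq.
Qed.

Lemma leq_sum_of_card_sublevel M k :
    (forall j, #|[set x in A | f x <= j]| <= M * 2 ^ j) -> M * 2 ^ k <= #|A| ->
  #|A| * k <= \sum_(x in A) f x + #|A|.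
Proof.
move=> sublevel_le A_ge; rewrite -sum_nat_const.
have truncation :
    \sum_(x in A) k <= \sum_(x in A) f x + \sum_(x in A) (k - f x).
  by rewrite -big_split leq_sum // => x _; rewrite -leq_subLR.
apply: leq_trans truncation _; rewrite leq_add2l sum_subn_sublevel.
apply: leq_trans A_ge; apply: (@leq_trans (\sum_(j < k) M * 2 ^ j)).
  by apply: leq_sum => j _.
rewrite -big_distrr leq_mul2l -[X in X <= _]mul1n -(predn_exp 2).
by rewrite leq_pred orbT.
Qed.

End SublevelSets.

Lemma strict_orderP n (P : {set 'I_n * 'I_n}) :
  reflect ((forall a, (a, a) \notin P) /\
           (forall a b c, (a, b) \in P -> (b, c) \in P -> (a, c) \in P))
          (strict_order P).
Proof.
apply: (iffP andP) => -[irr tr]; split.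
- exact/forallP.
- move=> a b c ab bc.
  by move/forallP/(_ a)/forallP/(_ b)/forallP/(_ c): tr; rewrite ab bc.
- exact/forallP.
- apply/forallP => a; apply/forallP => b; apply/forallP => c.
  by apply/implyP => /andP[]; exact: tr.
Qed.

Definition strictly_increasing n (P : {set 'I_n * 'I_n})
    (h : 'I_n -> nat) : Prop :=
  forall a b, (a, b) \in P -> h a < h b.

Lemma comparison_resultE n (P : {set 'I_n * 'I_n}) (h : 'I_n -> nat) a b :
    strictly_increasing P h ->
  comparison_result P a b =
    if comparison_result P a b == Incomparable then Incomparable
    else if h a < h b then Below else Above.
Proof.
move=> incP; rewrite /comparison_result; case: ifP => [/incP -> //|_].
by case: ifP => // /incP lt_ba; rewrite ltnNge ltnW.
Qed.

Definition incomparable_at n (t : decision_tree n) (P : {set 'I_n * 'I_n})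
    (i : nat) : bool :=
  nth false [seq q.2 == Incomparable | q <- run t P] i.

Section CommonIncreasingMap.

Variables (n : nat) (P Q : {set 'I_n * 'I_n}) (h : 'I_n -> nat).
Hypotheses (hP : strictly_increasing P h) (hQ : strictly_increasing Q h).

Lemma eq_comparison_result a b :
    (comparison_result P a b == Incomparable) =
      (comparison_result Q a b == Incomparable) ->
  comparison_result P a b = comparison_result Q a b.
Proof.
move=> eq_incomparable; rewrite (comparison_resultE _ _ hP).
by rewrite (comparison_resultE _ _ hQ) eq_incomparable.
Qed.

Lemma eq_take_run (t : decision_tree n) k :
    (forall i, i < k -> incomparable_at t P i = incomparable_at t Q i) ->
  take k (run t P) = take k (run t Q).
Proof.
elim: k t => [|k IHk] [|a b neq_ab next] bits //=.
have eq_ab := eq_comparison_result (bits 0 (ltn0Sn k)).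
rewrite eq_ab IHk // => i lt_ik.
by have := bits i.+1 lt_ik; rewrite /incomparable_at /= eq_ab.
Qed.

End CommonIncreasingMap.

Definition predecessors n (P : {set 'I_n * 'I_n}) (a : 'I_n) : {set 'I_n} :=
  [set b | (b, a) \in P].

Section Predecessors.

Variables (n : nat) (P : {set 'I_n * 'I_n}).
Hypothesis orderP : strict_order P.

Lemma card_predecessors_lt a : #|predecessors P a| < n.
Proof.
have [irr _] := strict_orderP _ orderP.
rewrite -[X in _ < X]card_ord -cardsT; apply/proper_card/properP.
by split; [exact: finset.subsetT|exists a; rewrite !inE ?irr].
Qed.

Lemma card_predecessors_increasing :
  strictly_increasing P (fun a => #|predecessors P a|).
Proof.
move=> a b ab; have [irr tr] := strict_orderP _ orderP.
apply/proper_card/properP; split; last by exists a; rewrite !inE ?irr.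
by apply/fintype.subsetP => c; rewrite !inE => ca; exact: tr ca ab.
Qed.

End Predecessors.

Lemma consistent_run n (t : decision_tree n) P : consistent P (run t P).
Proof. by elim: t => [//|a b neq_ab next IH] /=; rewrite eqxx IH. Qed.

Lemma consistent_take n (s : transcript n) P k :
  consistent P s -> consistent P (take k s).
Proof. by rewrite -{1}(cat_take_drop k s) /consistent all_cat => /andP[]. Qed.

Lemma known_eq n (P Q : {set 'I_n * 'I_n}) (s : transcript n) :
  known P s -> Q \in posets n -> consistent Q s -> Q = P.
Proof.
move=> /eqP/finset.setP/(_ Q).
by rewrite !inE => /[swap] -> /[swap] -> /esym/eqP.
Qed.

Section Algorithm.

Variables (phi : learning_algorithm) (n : nat).
Hypothesis n_gt0 : 0 < n.

Lemma known_comparisons P : P \in posets n ->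
  known P (take (comparisons phi P) (run (tree phi n) P)).
Proof.
move=> posetP; rewrite /comparisons; set s := run _ _.
set known_after := fun k => _.
have known_eventually : has known_after (iota 0 (size s).+1).
  apply/hasP; exists (size s); first by rewrite mem_iota ltnS leqnn.
  by rewrite /known_after take_size; exact: tree_identifies.
have := nth_find 0 known_eventually; rewrite nth_iota ?add0n //.
by move: known_eventually; rewrite has_find size_iota.
Qed.

Definition known_within j : {set {set 'I_n * 'I_n}} :=
  [set P in posets n | comparisons phi P <= j].

(* [insubd] never falls back on its default here: in a poset a point has fewer
   than [n] predecessors. *)
Definition poset_code j (P : {set 'I_n * 'I_n}) :
    {ffun 'I_n -> 'I_n} * {ffun 'I_j -> bool} :=
  ([ffun a => insubd a #|predecessors P a|],
   [ffun i : 'I_j => incomparable_at (tree phi n) P i]).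

Lemma poset_code_inj j : {in known_within j &, injective (poset_code j)}.
Proof.
move=> P Q /setIdP[posetP leP] /setIdP[posetQ _] [counts bits].
move: (posetP) (posetQ); rewrite !inE => orderP orderQ.
have eq_count a : #|predecessors P a| = #|predecessors Q a|.
  move/ffunP/(_ a)/(congr1 val): counts.
  by rewrite !ffunE !insubdK //; exact: card_predecessors_lt.
have incP := card_predecessors_increasing orderP.
have incQ : strictly_increasing Q (fun a => #|predecessors P a|).
  by move=> a b; rewrite !eq_count; exact: card_predecessors_increasing.
apply/esym/(known_eq (known_comparisons posetP) posetQ).
rewrite (eq_take_run incP incQ); first exact/consistent_take/consistent_run.
move=> i lt_i.
by move/ffunP/(_ (Ordinal (leq_trans lt_i leP))): bits; rewrite !ffunE.
Qed.

Lemma card_known_within j : #|known_within j| <= n ^ n * 2 ^ j.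
Proof.
rewrite -(card_in_imset (@poset_code_inj j)) (leq_trans (max_card _)) //.
by rewrite card_prod !card_ffun !card_ord card_bool.
Qed.

End Algorithm.

Lemma bipartite_posets n (A : {set 'I_n}) :
  powerset (finset.setX A (~: A)) \subset posets n.
Proof.
apply/fintype.subsetP => P; rewrite powersetE => /fintype.subsetP sub.
rewrite inE; apply/strict_orderP; split.
  by move=> a; apply/negP => /sub; rewrite !inE /= andbN.
by move=> a b c /sub + /sub; rewrite !inE /= => /andP[_ /negPf ->].
Qed.

Lemma card_posets_ge n : 2 ^ (n./2 * uphalf n) <= #|posets n|.
Proof.
pose A : {set 'I_n} := [set i : 'I_n | i < n./2].
have cardA : #|A| = n./2.
  rewrite -sum1dep_card -(big_ord_widen n (fun=> 1)); last by lia.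
  by rewrite sum1_card card_ord.
have cardCA : #|~: A| = uphalf n.
  by rewrite cardsCs finset.setCK cardA card_ord; lia.
rewrite -cardA -cardCA -cardsX -card_powerset.
exact/subset_leq_card/bipartite_posets.
Qed.

Lemma sqrn_half_uphalf n : n ^ 2 = 4 * (n./2 * uphalf n) + odd n.
Proof.
by rewrite uphalf_half -{1}(odd_double_half n) -mul2n; case: odd; nia.
Qed.

Lemma sum_comparisons_ge (phi : learning_algorithm) n : 0 < n ->
  #|posets n| * (n./2 * uphalf n) <=
    \sum_(P in posets n) comparisons phi P + #|posets n| * (n * up_log 2 n).+1.
Proof.
move=> n_gt0; set m := n./2 * uphalf n; set l := up_log 2 n.
have [le_m|lt_m] := leqP m (n * l).
  by apply: leq_trans (leq_addl _ _); rewrite leq_mul2l leqW ?orbT.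
have card_ge : n ^ n * 2 ^ (m - n * l) <= #|posets n|.
  apply: leq_trans (card_posets_ge n); rewrite -/m -{2}(subnKC (ltnW lt_m)).
  by rewrite expnD leq_mul2r [n * l]mulnC expnM leq_exp2r // up_logP ?orbT.
have := leq_sum_of_card_sublevel (card_known_within phi n_gt0) card_ge.
by rewrite mulnBr mulnS; lia.
Qed.

Lemma sqrn_le_exp2S k : k ^ 2 <= 2 ^ k.+1.
Proof.
elim: k => [//|k IHk]; have [k_lt3|k_ge3] := ltnP k 3.
  by case: k k_lt3 {IHk} => [|[|[|]]].
by rewrite (expnS 2); nia.
Qed.

Lemma sqrn_up_log2_le n : up_log 2 n ^ 2 <= 4 * n.
Proof.
have [n_le1|n_gt1] := leqP n 1; first by case: n n_le1 => [|[|]].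
have log_gt0 : 0 < up_log 2 n by rewrite up_log_gt0.
have lt_n := up_log_gtn (isT : 1 < 2) n_gt1.
apply: leq_trans (sqrn_le_exp2S _) _.
by rewrite -(prednK log_gt0) 2!expnS mulnA leq_pmul2l // ltnW.
Qed.

Local Open Scope classical_set_scope.
Local Open Scope ring_scope.

Section RealBounds.

Variable R : realType.

(* [1/4] accounts for odd [n], [1] for the averaging argument. *)
Definition comparison_error n : R := n%:R * (up_log 2 n)%:R + 5 / 4.

Lemma expected_comparisons_ge (phi : learning_algorithm) n : (0 < n)%N ->
  n%:R ^+ 2 / 4 - comparison_error n <= expected_comparisons R phi n.
Proof.
move=> n_gt0; rewrite /expected_comparisons /comparison_error.
have N_gt0 : 0 < #|posets n|%:R :> R.
  by rewrite ltr0n (leq_trans _ (card_posets_ge n)) // expn_gt0.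
have := sum_comparisons_ge phi n_gt0.
rewrite ler_pdivlMl // -natr_sum -(ler_nat R).
rewrite natrD !natrM -natr1 natrM => sum_ge.
have odd_le1 : (odd n)%:R <= 1 :> R by rewrite lern1 leq_b1.
rewrite -natrX sqrn_half_uphalf natrD !natrM; nra.
Qed.

Lemma cvg_natr_inv : n%:R^-1 @[n --> \oo] --> (0 : R).
Proof. by rewrite -cvg_shiftS; exact: cvg_harmonic. Qed.

Lemma cvg_up_log2_div : (up_log 2 n)%:R / n%:R @[n --> \oo] --> (0 : R).
Proof.
have sqr_cvg : ((up_log 2 n)%:R / n%:R) ^+ 2 @[n --> \oo] --> (0 : R).
  apply: (@squeeze_cvgr _ _ _ _ (fun=> 0) (fun n => 4 * n%:R^-1)).
  - near=> n.
    have n_gt0 : 0 < n%:R :> R by rewrite ltr0n; near: n; exact: nbhs_infty_gt.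
    rewrite sqr_ge0 exprMn exprVn ler_pdivrMr ?exprn_gt0 // [n%:R ^+ 2]expr2.
    by rewrite mulrA mulfVK ?gt_eqF // -natrX -natrM ler_nat sqrn_up_log2_le.
  - exact: cvg_cst.
  - rewrite -[X in _ --> X](mulr0 4).
    by apply: cvgMl_tmp; exact: cvg_natr_inv.
have <- : (fun n => Num.sqrt (((up_log 2 n)%:R / n%:R) ^+ 2)) =
          (fun n => (up_log 2 n)%:R / n%:R : R).
  by apply/funext => n; rewrite sqrtr_sqr ger0_norm ?divr_ge0.
rewrite -[in X in _ --> X]sqrtr0.
exact: continuous_cvg (@sqrt_continuous R 0) sqr_cvg.
Unshelve. all: by end_near. Qed.

Lemma cvg_comparison_error :
  comparison_error n / n%:R ^+ 2 @[n --> \oo] --> (0 : R).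
Proof.
have -> : (fun n => comparison_error n / n%:R ^+ 2) =
          (fun n => (up_log 2 n)%:R / n%:R + 5 / 4 * (n%:R^-1 * n%:R^-1) : R).
  apply/funext => n; rewrite /comparison_error.
  by case: n => [|n]; [rewrite expr2 !mul0r invr0 !mulr0 addr0|field].
have -> : 0 = 0 + 5 / 4 * (0 * 0) :> R by rewrite !mulr0 addr0.
apply: cvgD; first exact: cvg_up_log2_div.
by apply: cvgMl_tmp; apply: cvgM; exact: cvg_natr_inv.
Qed.

End RealBounds.

Theorem mainTheorem1 (R : realType) :
  exists g : nat -> R,
    (g n / n%:R ^+ 2 @[n --> \oo] --> (0 : R)) /\
    (forall (phi : learning_algorithm) (n : nat), (0 < n)%N ->
       n%:R ^+ 2 / 4 - g n <= expected_comparisons R phi n).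
Proof.
exists (comparison_error R); split; first exact: cvg_comparison_error.
exact: expected_comparisons_ge.
Qed.
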